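(* Let $\widehat{\mathrm{Pal}}(x)$ be the palinomial induced by a singly-derived or doubly-derived $(\hat{n},\hat{b})$-palintiple $\hat{p}$ constructed from an $(n,b)$-palintiple $p=(d_k,d_{k-1},\ldots,d_0)_b$, and let $\mathrm{Pal}(x)$ be the palinomial induced by $p$. Then $$\widehat{\mathrm{Pal}}(x)=(x-\hat{b})(d_kx^2-x+d_0)\,\frac{\mathrm{Pal}(x)}{(n-1)(x-b)}$$ if $p$ is a 1089 palintiple, and $$\widehat{\mathrm{Pal}}(x)=(x-\hat{b})(d_kx+d_0)\,\frac{\mathrm{Pal}(x)}{c_k(x-b)}$$ if $p$ is shifted-symmetric, where $c_k$ is the $k$th carry of $p$.
   Context: For integers $1<n<b$ and $k\ge 1$, write $(d_k,\ldots,d_0)_b=\sum_{j=0}^k d_jb^j$ with digits $0\le d_j<b$. It is called a $(k+1)$-digit $(n,b)$-palintiple (with multiplier $n$ and base $b$) if $d_k\neq 0$ (no leading zeros) and $(d_k,d_{k-1},\ldots,d_0)_b=n\,(d_0,d_1,\ldots,d_k)_b$. Its carries $c_k,\ldots,c_0$ are those of the base-$b$ single-digit multiplication: $c_0=0$ and $n d_{k-j}+c_j=d_j+b\,c_{j+1}$ for $0\le j\le k$, with $c_{k+1}=0$. The palintiple is shifted-symmetric if $c_j=c_{k-j+1}$ for all $0\le j\le k$ (in this case $c_k\neq 0$). A 1089 $(n,b)$-palintiple is an $(n,b)$-palintiple whose Young graph $Y(n,b)$ is isomorphic to $Y(9,10)$; by a theorem of Kendrick this is equivalent to the condition that $n+1$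 divides $b$, which may be taken as the definition here. Given an $(n,b)$-palintiple $p=(d_k,\ldots,d_0)_b$ and a base $\hat{b}>b$: a $(k+2)$-digit $(\hat{n},\hat{b})$-palintiple with carries $(\hat{c}_{k+1},\ldots,\hat{c}_0)=(d_k,\ldots,d_0,0)$ is called singly-derived (constructed from $p$); a $(k+3)$-digit $(\hat{n},\hat{b})$-palintiple with carries $(\hat{c}_{k+2},\ldots,\hat{c}_0)=(0,d_k,\ldots,d_0,0)$ is called doubly-derived (constructed from $p$). The palinomial induced by an $(n,b)$-palintiple $(d_k,\ldots,d_0)_b$ is $\mathrm{Pal}(x)=\sum_{j=0}^k(d_j-nd_{k-j})x^j$; it is divisible by $x-b$. *)

(* Defs.v *)
From HB Require Import structures.
From mathcomp Require Import all_boot all_order all_algebra.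

Set Implicit Arguments.
Unset Strict Implicit.
Unset Printing Implicit Defensive.

Import Order.TTheory GRing.Theory Num.Theory.

(* The digit string (d_k, ..., d_0)_b is encoded by the little-endian sequence
   [:: d_0; ...; d_k], so that the index in the sequence is the exponent of b
   and k is the predecessor of its size; carries (c_k, ..., c_0) are
   encoded in the same way. *)

Notation digit s j := (nth 0%N s j).

Definition value (b : nat) (s : seq nat) : nat :=
  \sum_(j < size s) digit s j * b ^ j.

Definition top (s : seq nat) : nat := (size s).-1.

(* 1 < size p is the condition 1 <= k. *)
Definition palintiple (n b : nat) (p : seq nat) : Prop :=
  [/\ 1 < n < b,
      1 < size p,
      all (fun d => d < b) p,
      digit p (top p) != 0
    & value b p = n * value b (rev p)].

(* For j = k, digit c j.+1 is read past the end of c and hence is 0, which is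
   the condition c_{k+1} = 0. *)
Definition carries (n b : nat) (p c : seq nat) : Prop :=
  [/\ size c = size p,
      digit c 0 = 0
    & forall j, j <= top p ->
        n * digit p (top p - j) + digit c j = digit p j + b * digit c j.+1].

(* For j = 0, digit c (top c - j).+1 is c_{k+1} = 0, read past the end of c. *)
Definition shifted_symmetric (c : seq nat) : Prop :=
  forall j, j <= top c -> digit c j = digit c (top c - j).+1.

Definition palintiple1089 (n b : nat) (p : seq nat) : Prop :=
  palintiple n b p /\ n.+1 %| b.

(* The size condition in carries forces ph to have k+2 digits in the first
   definition and k+3 digits in the second one. *)
Definition singly_derived (n b : nat) (p : seq nat)
    (nh bh : nat) (ph : seq nat) : Prop :=
  [/\ palintiple n b p, b < bh, palintiple nh bh ph
    & carries nh bh ph (0 :: p)].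

Definition doubly_derived (n b : nat) (p : seq nat)
    (nh bh : nat) (ph : seq nat) : Prop :=
  [/\ palintiple n b p, b < bh, palintiple nh bh ph
    & carries nh bh ph (0 :: rcons p 0)].

Local Open Scope ring_scope.

Definition palinomial (n : nat) (p : seq nat) : {poly int} :=
  \poly_(j < size p)
    ((digit p j)%:Z - n%:Z * (digit p (top p - j))%:Z).

(* Polynomials over int are seen in their field of fractions, the field of
   rational functions over the rationals, so that quotients are exact. *)
Definition ratfun (q : {poly int}) : {fraction {poly int}} :=
  @FracField.tofrac _ q.

(* Main.v *)
Require Import Defs.
From HB Require Import structures.
From mathcomp Require Import all_boot all_order all_algebra.
From mathcomp Require Import zify ring.
Import Order.TTheory GRing.Theory Num.Theory.
Local Open Scope ring_scope.

Set Implicit Arguments.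
Unset Strict Implicit.

(** Write [C] for the carries and [D = \sum_j d_j x^j] for the digits of [p].
    The carry equations say that the coefficients of the palinomial are
    [c_j - b c_{j+1}], so [Pal = (x - b) Q] with [Q = \sum_j c_{j+1} x^j]
    ([palinomial_carries]).  Applied to a derived palintiple, whose carries are
    the digits of [p], the same identity reads [(x - bh) D], for a single as
    well as for a double derivation.  What remains is to divide [D] by [Q].

    Eliminating the mirrored digit between the carry equations at [j] and
    [k - j] expresses [(n^2 - 1) d_j] by carries alone ([digit_of_carries]).
    If [C] is shifted-symmetric, only [c_j] and [c_{j+1}] occur, with constant
    coefficients that the cases [j = 0] and [j = k] identify as
    [(n^2 - 1) d_k / c_k] and [(n^2 - 1) d_0 / c_k] ([shifted_symmetric_digit]).

    If [b = (n + 1) m], reduction modulo [n + 1] gives [c_j = c_{k-j}], because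
    carries are smaller than [n] ([carries_sym]).  Hence
    [(n - 1) d_j = m c_{j+1} - c_j + n m c_{j-1}] ([digit_recurrence]), and the
    ends [j = 0] and [j = k] show that [d_0 = m] and [d_k = n m] as soon as
    [c_1 = n - 1].  Now [c_1] is nonzero and less than [n], so it suffices that
    [n - 1] divides every carry.  Modulo [n - 1] the recurrence is
    [c_j = m (c_{j-1} + c_{j+1})], with [c_0 = m c_1 = 0]: read upwards it kills
    [m^j c_j], and then read as a formula for [c_j] it strips the factors [m]
    one after the other ([dvd_of_recurrence]).  That [c_1] is nonzero is the
    case [j = k] again, since [d_k] is nonzero. *)

(** * Palinomials and carries *)

Definition digit_poly (s : seq nat) : {poly int} :=
  \poly_(j < size s) (digit s j)%:Z.

Lemma coef_digit_poly (s : seq nat) (i : nat) :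
  (digit_poly s)`_i = (digit s i)%:Z.
Proof.
by rewrite coef_poly; case: ltnP => // le_s_i; rewrite (nth_default 0%N).
Qed.

Lemma digit_poly_rcons0 (s : seq nat) : digit_poly (rcons s 0%N) = digit_poly s.
Proof.
apply/polyP => i; rewrite !coef_digit_poly nth_rcons.
by case: ltngtP => // [lt_s_i | ->]; rewrite nth_default // ltnW.
Qed.

Lemma palinomial_carries (n b : nat) (p c : seq nat) :
  carries n b p c ->
  palinomial n p = ('X - (b%:Z)%:P) * digit_poly (behead c).
Proof.
move=> [size_c c0 carry]; apply/polyP => i.
rewrite mulrBl coefB coefXM coefCM !coef_digit_poly !nth_behead coef_poly.
have -> : (if i == 0 then 0 else (digit c i.-1.+1)%:Z) = (digit c i)%:Z.
  by case: i => [|i] /=; rewrite ?c0.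
case: ltnP => [lt_i | le_i]; last first.
  by rewrite !nth_default ?size_c // ?leqW //; ring.
by have := carry i; rewrite /top; lia.
Qed.

(** The carries of a derived palintiple start with a [0], and dropping it leaves
    the digits of [p], up to a leading zero in the doubly-derived case. *)
Lemma derived_palinomial (n b nh bh : nat) (p ph : seq nat) :
  singly_derived n b p nh bh ph \/ doubly_derived n b p nh bh ph ->
  palinomial nh ph = ('X - (bh%:Z)%:P) * digit_poly p.
Proof.
case=> -[_ _ _ carry]; rewrite (palinomial_carries carry) //=.
by rewrite digit_poly_rcons0.
Qed.

(** The quotient of the statement, with both palinomials replaced by their
    factorizations: it is exact once [s D = A Q]. *)
Lemma ratfun_factorization (s x y : int) (A Q D : {poly int}) :
  s != 0 -> s *: D = A * Q ->
  ratfun (('X - x%:P) * D) =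
  ratfun (('X - x%:P) * A)
    * (ratfun (('X - y%:P) * Q) / ratfun (s *: ('X - y%:P))).
Proof.
move=> s_neq0 DAQ.
have nz : ratfun (s *: ('X - y%:P)) != 0.
  rewrite /ratfun tofrac_eq0 -mul_polyC.
  by rewrite mulf_neq0 ?polyC_eq0 ?polyXsubC_eq0.
rewrite mulrA; apply: (canRL (mulfK nz)).
rewrite /ratfun -!rmorphM /=; congr (@FracField.tofrac _ _).
have -> : ('X - x%:P) * A * (('X - y%:P) * Q) =
  ('X - x%:P) * ('X - y%:P) * (A * Q) by ring.
by rewrite -DAQ -!mul_polyC; ring.
Qed.

(** * Digits in terms of carries *)

(** Eliminate [d_{k-j}] between the carry equations at [j] and at [k - j]. *)
Lemma digit_of_carries (n b : nat) (p c : seq nat) (j : nat) :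
  carries n b p c -> (j <= top p)%N ->
  (n%:Z ^+ 2 - 1) * (digit p j)%:Z =
  b%:Z * (digit c j.+1)%:Z - (digit c j)%:Z
    - n%:Z * (digit c (top p - j))%:Z
    + n%:Z * b%:Z * (digit c (top p - j).+1)%:Z.
Proof.
move=> [_ _ carry] le_jk.
have := carry _ (leq_subr j (top p)); have := carry _ le_jk.
rewrite subKn // => /(congr1 Posz) + /(congr1 Posz).
rewrite !PoszD !PoszM => E1 E2.
have -> : (digit c j)%:Z = (digit p j)%:Z + b%:Z * (digit c j.+1)%:Z
  - n%:Z * (digit p (top p - j))%:Z by rewrite -E1; ring.
have -> : (digit c (top p - j))%:Z = (digit p (top p - j))%:Z
  + b%:Z * (digit c (top p - j).+1)%:Z - n%:Z * (digit p j)%:Z.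
  by rewrite -E2; ring.
by ring.
Qed.

Lemma carries_past (n b : nat) (p c : seq nat) (j : nat) :
  carries n b p c -> (top p < j)%N -> digit c j = 0%N.
Proof.
case=> size_c _ _; rewrite /top => lt_j.
by rewrite nth_default // size_c; lia.
Qed.

(** * Shifted-symmetric carries *)

Lemma shifted_symmetric_digit (n b : nat) (p c : seq nat) (j : nat) :
  (1 < n)%N -> carries n b p c -> shifted_symmetric c ->
  (digit c (top c))%:Z * (digit p j)%:Z =
  (digit p (top p))%:Z * (digit c j)%:Z + (digit p 0)%:Z * (digit c j.+1)%:Z.
Proof.
move=> n_gt1 carry sym.
have topE : top c = top p by rewrite /top; case: carry => ->.
have [lt_kj | le_jk] := ltnP (top p) j.
  have -> : digit p j = 0%N.
    by rewrite nth_default //; move: lt_kj; rewrite /top; lia.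
  by rewrite (carries_past carry lt_kj) (carries_past carry (leqW lt_kj)); ring.
(* Under the symmetry the four carries of [digit_of_carries] are only two. *)
have two_carries i : (i <= top p)%N -> (n%:Z ^+ 2 - 1) * (digit p i)%:Z =
    (n%:Z * b%:Z - 1) * (digit c i)%:Z + (b%:Z - n%:Z) * (digit c i.+1)%:Z.
  move=> le_i; rewrite (digit_of_carries carry le_i).
  have -> : digit c (top p - i).+1 = digit c i by rewrite (sym i) topE.
  have -> : digit c (top p - i) = digit c i.+1.
    by rewrite (sym (top p - i)%N) topE ?leq_subr // subKn.
  by ring.
have D0 := two_carries 0%N (leq0n _); have Dk := two_carries _ (leqnn _).
have Dj := two_carries _ le_jk.
have c0 : digit c 0 = 0%N by case: carry.
have c1 : digit c 1 = digit c (top p).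
  by rewrite (sym (top p)) topE ?subnn.
rewrite c0 c1 !mulr0 add0r in D0.
rewrite (carries_past carry (ltnSn _)) mulr0 addr0 in Dk.
have nz : n%:Z ^+ 2 - 1 != 0 by rewrite subr_eq0 sqrf_eq1; lia.
apply: (mulfI nz); rewrite topE.
by rewrite mulrCA Dj [RHS]mulrDr !(mulrA (n%:Z ^+ 2 - 1)) Dk D0; ring.
Qed.

Lemma shifted_symmetric_top (n b : nat) (p c : seq nat) :
  (1 < n)%N -> carries n b p c -> digit p (top p) != 0%N ->
  shifted_symmetric c -> digit c (top c) != 0%N.
Proof.
move=> n_gt1 carry dk_neq0 sym; apply/eqP => ck0.
have topE : top c = top p by rewrite /top; case: carry => ->.
have c0 : digit c 0 = 0%N by case: carry.
have := digit_of_carries carry (leqnn (top p)).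
rewrite subnn (carries_past carry (ltnSn _)) -topE ck0 c0.
have -> : digit c 1 = 0%N by have := sym _ (leqnn (top c)); rewrite subnn ck0.
rewrite topE !mulr0 !subr0 => /eqP; rewrite mulf_eq0 subr_eq0 sqrf_eq1; lia.
Qed.

(** * Existence of carries *)

Lemma value_cons (b x : nat) (s : seq nat) :
  value b (x :: s) = (x + b * value b s)%N.
Proof.
rewrite /value big_ord_recl /= expn0 muln1; congr (_ + _)%N.
by rewrite big_distrr /=; apply: eq_bigr => i _; rewrite expnS mulnCA.
Qed.

(** An equation between values determines the carries of the multiplication of
    [q] by [n].  The incoming carry [a] makes the induction on the digits go
    through: the carry out of the lowest digit enters the rest. *)
Lemma carries_mul_digits (n b a : nat) (p q : seq nat) :
  (a < n)%N -> size p = size q ->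
  all (fun d => d < b)%N p -> all (fun d => d < b)%N q ->
  value b p = (n * value b q + a)%N ->
  exists2 e : nat -> nat, (e 0%N = a /\ e (size p) = 0%N) &
    (forall j, e j < n)%N /\ forall j, (j < size p)%N ->
      (n * digit q j + e j = digit p j + b * e j.+1)%N.
Proof.
elim: p q a => [|x p IH] [|y q] // a lt_an.
  move=> _ _ _; rewrite /value !big_ord0 muln0 => a0.
  by exists (fun=> 0%N); split=> // j; apply: leq_ltn_trans lt_an.
case=> size_pq /= /andP[lt_xb p_lt] /andP[lt_yb q_lt]; rewrite !value_cons => E.
have b_gt0 : (0 < b)%N by apply: leq_ltn_trans lt_xb.
(* Modulo [b] this identifies [x] and the outgoing carry. *)
have E' : (x + b * value b p = n * y + a + b * (n * value b q))%N.
  by rewrite E; ring.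
have xE : x = ((n * y + a) %% b)%N.
  have := congr1 (modn^~ b) E'.
  by rewrite /= !(addnC _ (b * _)%N) !(mulnC b) !modnMDl (modn_small lt_xb).
have dE := divn_eq (n * y + a) b; rewrite -xE in dE.
have lt_n : ((n * y + a) %/ b < n)%N by rewrite ltn_divLR //; nia.
have [|e [e0 ek] [e_lt e_carry]] := IH q _ lt_n size_pq p_lt q_lt.
  by apply/eqP; rewrite -(eqn_pmul2l b_gt0); apply/eqP; lia.
exists (fun j => if j is j'.+1 then e j' else a); first by [].
split=> [[|j] // | [_ /=|j /= lt_j]]; last exact: e_carry.
by rewrite e0; lia.
Qed.

Lemma palintiple_carries (n b : nat) (p : seq nat) :
  palintiple n b p ->
  exists2 c, carries n b p c & forall j, (digit c j < n)%N.
Proof.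
case=> /andP[n_gt1 _] size_p p_lt _ E.
have := @carries_mul_digits n b 0 p (rev p).
rewrite size_rev all_rev addn0 => /(_ (ltnW n_gt1) erefl p_lt p_lt E).
move=> [e [e0 ek] [e_lt e_carry]].
have cE j : (j <= size p)%N -> digit (mkseq e (size p)) j = e j.
  rewrite leq_eqVlt => /predU1P[-> | lt_j]; last by rewrite nth_mkseq.
  by rewrite nth_default ?size_mkseq.
exists (mkseq e (size p)).
  split=> [|| j le_j]; [by rewrite size_mkseq | by rewrite cE |].
  have lt_j : (j < size p)%N by move: le_j; rewrite /top; lia.
  rewrite (cE _ lt_j) (cE _ (ltnW lt_j)) -e_carry // nth_rev // /top.
  by congr (_ * digit p _ + _)%N; lia.
move=> j; have [/cE-> // | lt_j] := leqP j (size p).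
by rewrite nth_default ?size_mkseq; lia.
Qed.

(** * Bases divisible by the successor of the multiplier *)

(** [digit_of_carries] modulo [n + 1]; carries below [n] that are congruent
    modulo [n + 1] are equal, since their difference is less than [n]. *)
Lemma carries_sym (n m : nat) (p c : seq nat) (j : nat) :
  carries n (n.+1 * m) p c -> (forall i, digit c i < n)%N ->
  (j <= top p)%N -> digit c (top p - j) = digit c j.
Proof.
move=> carry c_lt le_j; have := digit_of_carries carry le_j.
have := c_lt j; have := c_lt (top p - j)%N.
move: (digit c (top p - j)) (digit c j) (digit c j.+1)
  (digit c (top p - j).+1) (digit p j) => u v w z d.
move=> lt_u lt_v E.
have dv : (n.+1%:Z %| u%:Z - v%:Z)%Z.
  apply/dvdzP.
  exists ((n%:Z - 1) * d%:Z - m%:Z * w%:Z + u%:Z - n%:Z * m%:Z * z%:Z).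
  have -> : v%:Z = (n.+1 * m)%:Z * w%:Z - n%:Z * u%:Z
    + n%:Z * (n.+1 * m)%:Z * z%:Z - (n%:Z ^+ 2 - 1) * d%:Z by rewrite E; ring.
  by rewrite PoszM -addn1 PoszD; ring.
move/dvdzP: dv => [q Eq].
(* [q (n + 1)] is a difference of two numbers in [0, n[. *)
have q0 : q = 0 by nia.
by rewrite q0 in Eq; lia.
Qed.

(** At [j = 0] the absent carry [c_{-1}] counts as [0]; with truncated
    predecessors it is [c_0], which is also [0]. *)
Lemma digit_recurrence (n m : nat) (p c : seq nat) (j : nat) :
  carries n (n.+1 * m) p c -> (forall i, digit c i < n)%N ->
  (n%:Z - 1) * (digit p j)%:Z =
  m%:Z * (digit c j.+1)%:Z - (digit c j)%:Z
    + n%:Z * m%:Z * (digit c j.-1)%:Z.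
Proof.
move=> carry c_lt; have c0 : digit c 0 = 0%N by case: carry.
have sym i := @carries_sym n m p c i carry c_lt.
have [lt_kj | le_jk] := ltnP (top p) j.
  have past : forall i, (top p < i)%N -> digit c i = 0%N.
    by move=> i; apply: carries_past carry.
  have -> : digit p j = 0%N.
    by rewrite nth_default //; move: lt_kj; rewrite /top; lia.
  have -> : digit c j.-1 = 0%N.
    have [->|?] := eqVneq j.-1 (top p); last by apply: past; lia.
    by rewrite -(sym _ (leqnn _)) subnn.
  by rewrite !past 1?leqW //; ring.
have mirror : digit c (top p - j).+1 = digit c j.-1.
  case: j le_jk => [_|j lt_j] /=; last by rewrite subnSK // sym // ltnW.
  by rewrite subn0 c0 (carries_past carry).
have nz : n%:Z + 1 != 0 by lia.
apply: (mulfI nz); rewrite mulrA.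
have -> : (n%:Z + 1) * (n%:Z - 1) = n%:Z ^+ 2 - 1 by ring.
rewrite (digit_of_carries carry le_jk) mirror (sym _ le_jk).
by rewrite PoszM -addn1 PoszD; ring.
Qed.

(** Since [m] may share factors with [d], it cannot be cancelled; the upward reading of the
    recurrence bounds the power of [m] that kills each entry, uniformly because
    [e] has finite support, and the downward reading lowers that power. *)
Lemma dvd_of_recurrence (d m : int) (e : nat -> int) (k : nat) :
  e 0%N = 0 -> (forall j, (k < j)%N -> e j = 0) -> (d %| m * e 1%N)%Z ->
  (forall j, (d %| e j.+1 - m * (e j + e j.+2))%Z) ->
  forall j, (d %| e j)%Z.
Proof.
move=> e0 e_past e1 e_rec.
have up j : (d %| m ^+ j * e j)%Z && (d %| m ^+ j.+1 * e j.+1)%Z.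
  elim: j => [|j /andP[IHj IHj1]]; first by rewrite e0 mulr0 dvdz0.
  rewrite IHj1 /=.
  have -> : m ^+ j.+2 * e j.+2 = m ^+ j.+1 * e j.+1
    - m ^+ j.+1 * (e j.+1 - m * (e j + e j.+2)) - m ^+ 2 * (m ^+ j * e j).
    by rewrite !exprS; ring.
  by rewrite !rpredB // dvdz_mull.
have down N : (forall j, (d %| m ^+ N * e j)%Z) -> forall j, (d %| e j)%Z.
  elim: N => [|N IH] dv j; first by have := dv j; rewrite mul1r.
  apply: IH => -[|i]; first by rewrite e0 mulr0 dvdz0.
  have -> : m ^+ N * e i.+1 = m ^+ N * (e i.+1 - m * (e i + e i.+2))
    + (m ^+ N.+1 * e i + m ^+ N.+1 * e i.+2) by rewrite exprS; ring.
  by rewrite !rpredD // dvdz_mull.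
apply: (down k) => j; have [/e_past-> | le_jk] := ltnP k j.
  by rewrite mulr0 dvdz0.
rewrite -(subnK le_jk) exprD -mulrA dvdz_mull //.
by case/andP: (up j).
Qed.

Lemma first_carry (n m : nat) (p c : seq nat) :
  (1 < n)%N -> digit p (top p) != 0%N ->
  carries n (n.+1 * m) p c -> (forall i, digit c i < n)%N ->
  (digit c 1)%:Z = n%:Z - 1.
Proof.
move=> n_gt1 dk_neq0 carry c_lt.
have c0 : digit c 0 = 0%N by case: carry.
have rec j := @digit_recurrence n m p c j carry c_lt.
have dv : (n%:Z - 1 %| (digit c 1)%:Z)%Z.
  apply: (@dvd_of_recurrence _ m%:Z (fun j => (digit c j)%:Z) (top p)).
  - by rewrite c0.
  - by move=> j lt_j; rewrite (carries_past carry).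
  - apply/dvdzP; exists (digit p 0)%:Z; have := rec 0%N.
    by rewrite /= c0 mulr0 subr0 addr0 mulrC => ->; rewrite mulrC.
  - move=> j; apply/dvdzP; exists (m%:Z * (digit c j)%:Z - (digit p j.+1)%:Z).
    by rewrite [RHS]mulrC mulrBr (rec j.+1) /=; ring.
have c1_neq0 : digit c 1 != 0%N.
  apply/eqP => c1; have := rec (top p).
  rewrite (carries_past carry (ltnSn _)).
  have -> : digit c (top p) = 0%N.
    by rewrite -(carries_sym carry c_lt (leqnn _)) subnn.
  have -> : digit c (top p).-1 = 0%N.
    case E : (top p) => [|k] //=.
    have lt_k : (k <= top p)%N by rewrite E.
    by rewrite -(carries_sym carry c_lt lt_k) E subSnn.
  by move/eqP; rewrite !mulr0 !subr0 mulf_eq0; lia.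
have := c_lt 1%N; move/dvdzP: dv => [q Eq] lt_c1.
have q1 : q = 1 by nia.
by rewrite Eq q1 mul1r.
Qed.

Lemma palintiple1089_digit (n m : nat) (p c : seq nat) (j : nat) :
  (1 < n)%N -> digit p (top p) != 0%N ->
  carries n (n.+1 * m) p c -> (forall i, digit c i < n)%N ->
  (n%:Z - 1) * (digit p j)%:Z =
  (digit p (top p))%:Z * (digit c j.-1)%:Z - (digit c j)%:Z
    + (digit p 0)%:Z * (digit c j.+1)%:Z.
Proof.
move=> n_gt1 dk_neq0 carry c_lt.
have c0 : digit c 0 = 0%N by case: carry.
have c1 := first_carry n_gt1 dk_neq0 carry c_lt.
have rec i := @digit_recurrence n m p c i carry c_lt.
have nz : n%:Z - 1 != 0 by lia.
have -> : (digit p 0)%:Z = m%:Z.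
  by apply: (mulfI nz); rewrite rec /= c1 c0; ring.
have -> : (digit p (top p))%:Z = n%:Z * m%:Z.
  apply: (mulfI nz); rewrite rec /= (carries_past carry (ltnSn _)).
  have -> : digit c (top p) = 0%N.
    by rewrite -(carries_sym carry c_lt (leqnn _)) subnn.
  case E : (top p) => [|k].
    have c1_eq0 : digit c 1 = 0%N by rewrite (carries_past carry) ?E.
    by rewrite c1_eq0 in c1; lia.
  have lt_k : (k <= top p)%N by rewrite E.
  by rewrite /= -(carries_sym carry c_lt lt_k) E subSnn c1; ring.
by rewrite rec; ring.
Qed.

(** * The induced palinomials *)

Unset Implicit Arguments.
Set Strict Implicit.

Theorem corollary6 (n b : nat) (p : seq nat) (nh bh : nat) (ph : seq nat)
    (hp : palintiple n b p)
    (hph : singly_derived n b p nh bh ph \/ doubly_derived n b p nh bh ph) :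
  (palintiple1089 n b p ->
     ratfun (palinomial nh ph) =
       ratfun (('X - (bh%:Z)%:P)
               * ((digit p (top p))%:Z *: 'X^2 - 'X + ((digit p 0)%:Z)%:P))
       * (ratfun (palinomial n p)
          / ratfun ((n%:Z - 1) *: ('X - (b%:Z)%:P))))
  /\
  (forall c : seq nat, carries n b p c -> shifted_symmetric c ->
     ratfun (palinomial nh ph) =
       ratfun (('X - (bh%:Z)%:P)
               * ((digit p (top p))%:Z *: 'X + ((digit p 0)%:Z)%:P))
       * (ratfun (palinomial n p)
          / ratfun ((digit c (top c))%:Z *: ('X - (b%:Z)%:P)))).
Proof.
have [/andP[n_gt1 _] _ _ dk_neq0 _] := hp.
rewrite (derived_palinomial hph); split.
  case=> _ /dvdnP[m bE].
  have [c carry c_lt] := palintiple_carries hp.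
  rewrite (palinomial_carries carry); apply: ratfun_factorization; first by lia.
  rewrite bE mulnC in carry.
  apply/polyP => i; rewrite coefZ [in RHS]mulrDl [in RHS]mulrBl !coefD coefN.
  rewrite -scalerAl coefZ coefCM coefXM coefXnM !coef_digit_poly !nth_behead.
  rewrite (palintiple1089_digit _ n_gt1 dk_neq0 carry c_lt).
  by have c0 : digit c 0 = 0%N by [case: carry]; case: i => [|[|i]] /=;
    rewrite ?c0 ?mulr0 // ?subn2.
move=> c carry sym; rewrite (palinomial_carries carry).
apply: ratfun_factorization.
  exact: shifted_symmetric_top n_gt1 carry dk_neq0 sym.
apply/polyP => i; rewrite coefZ [in RHS]mulrDl coefD -scalerAl coefZ.
rewrite coefCM coefXM.
rewrite !coef_digit_poly !nth_behead (shifted_symmetric_digit _ n_gt1 carry sym).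
by have c0 : digit c 0 = 0%N by [case: carry]; case: i => [|i] /=; rewrite ?c0.
Qed.
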